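(* Let $G$ be a Garside group and $x\in G$. For each pair $x_1,x_2\in C^*(x)$ with $T(x_1)=T(x_2)$ and for each $u_1\in A(x_1)$, there exists $u_2\in A(x_2)$ such that $T(x_1^{u_1})=T(x_2^{u_2})$.
   Context: Garside groups. A monoid $M$ is atomic if it is generated by its atoms (elements $x\ne1$ such that $x=yz$ implies $y=1$ or $z=1$) and every $x\in M$ has a finite norm $\|x\|$, the maximal number of factors in an expression of $x$ as a product of atoms. A Garside monoid is a cancellative atomic monoid $M$ in which any two elements have left and right greatest common divisors and left and right least common multiples, together with a Garside element $\Delta\in M$: its left divisors coincide with its right divisors, and they form a finite set $S$ (the simple elements) generating $M$. A Garside group $G$ is the group of fractions of a Garside monoid $M$. For $x,y\in G$, $x\prec y$ means $x^{-1}y\in M$ (a partial order on $G$), and $x\wedge y$, $x\vee y$ are the greatest lower bound and least upper bound with respect to $\prec$. Write $x^u=u^{-1}xu$. For $q\in\mathbb{Z}$ the cycling operation of order $q$ is $\mathrm{c}_q(x)=x^{x\wedge\Delta^q}$, and $G_q=\{x\in G\mid \mathrm{c}_q^N(x)=x\text{ for some }N>0\}$. With $C(x)$ the conjugacy class of $x$, the fully refined summit set is $C^*(x)=C(x)\cap\bigcap_{q\in\mathbb{Z}}G_q$. For $y\in G$, $A(y)$ denotes the set of $\prec$-minimal elements of $\{u\in S\setminus\{1\}\mid y^u\in C^*(y)\}$. The full cycling trajectory of $y\in G$ is $$T(y)=\{\mathrm{c}_{q_k}\cdots\mathrm{c}_{q_2}\mathrm{c}_{q_1}(y)\mid q_i\in\mathbb{Z},\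 k\ge0\}.$$ *)

(* Defs.v *)
From HB Require Import structures.
From mathcomp Require Import all_boot ssralg ssrint.
From mathcomp Require Import boolp classical_sets functions cardinality.

Set Implicit Arguments.
Unset Strict Implicit.
Unset Printing Implicit Defensive.

Local Open Scope classical_set_scope.
Local Open Scope group_scope.

Definition is_glb (T : Type) (le : T -> T -> Prop) (x y d : T) : Prop :=
  [/\ le d x, le d y & forall e, le e x -> le e y -> le e d].

Definition is_lub (T : Type) (le : T -> T -> Prop) (x y m : T) : Prop :=
  [/\ le x m, le y m & forall e, le x e -> le y e -> le m e].

Section Monoid.
Variable M : monoidType.
Implicit Types (x y z a : M) (s : seq M) (A : set M).

Definition ldvd x y : Prop := exists z, y = x * z.
Definition rdvd x y : Prop := exists z, y = z * x.

Definition factorization A x s : Prop :=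
  (forall a, a \in s -> A a) /\ x = \prod_(a <- s) a.

Definition generates A : Prop := forall x, exists s, factorization A x s.

Definition atom : set M :=
  [set x | x <> 1 /\ forall y z, x = y * z -> y = 1 \/ z = 1].

Definition is_norm x (n : nat) : Prop :=
  (exists2 s, factorization atom x s & size s = n) /\
  (forall s, factorization atom x s -> (size s <= n)%N).

Definition atomic : Prop :=
  generates atom /\ forall x, exists n, is_norm x n.

Definition cancellative : Prop :=
  (forall x y z, x * y = x * z -> y = z) /\
  (forall x y z, y * x = z * x -> y = z).

(* The left gcd is an infimum for left divisibility; the right lcm, being the
   least common right multiple, is a supremum for the same relation. *)
Definition has_gcds_lcms : Prop := forall x y,
  [/\ exists d, is_glb ldvd x y d, exists d, is_glb rdvd x y d,
      exists m, is_lub rdvd x y m & exists m, is_lub ldvd x y m].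

Definition simples (Delta : M) : set M := [set a | ldvd a Delta].

Definition garside_element (Delta : M) : Prop :=
  [/\ forall a, ldvd a Delta <-> rdvd a Delta,
      finite_set (simples Delta) & generates (simples Delta)].

Definition garside_monoid (Delta : M) : Prop :=
  [/\ cancellative, atomic, has_gcds_lcms & garside_element Delta].

End Monoid.

Definition expgz (G : groupType) (g : G) (q : int) : G :=
  match q with Posz n => g ^+ n | Negz n => g ^- n.+1 end.

Definition group_of_fractions (M : monoidType) (G : groupType) (iota : M -> G)
    : Prop :=
  [/\ monoid_morphism iota, injective iota &
      forall g : G, exists a b : M, g = iota a * (iota b)^-1].

(* A Garside group [G] is presented by the inclusion [iota : M -> G] of its
   Garside monoid together with the Garside element [Delta : M]. *)
Section GarsideGroup.
Variables (M : monoidType) (Delta : M) (G : groupType) (iota : M -> G).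
Implicit Types (x y u v : G) (q : int).

Definition prec x y : Prop := range iota (x^-1 * y).

(* In a Garside group the infimum exists and is unique; the default value 1
   of [xget] is then never used. *)
Definition meet x y : G := xget 1 [set d | is_glb prec x y d].

Definition cycling q x : G := x ^ (meet x (expgz (iota Delta) q)).

Definition cyclic_part q : set G :=
  [set x | exists2 N, (0 < N)%N & iter N (cycling q) x = x].

Definition conj_class x : set G := [set x ^ u | u in [set: G]].

Definition summit x : set G :=
  conj_class x `&` \bigcap_(q in [set: int]) cyclic_part q.

Definition summit_conjugators y : set G :=
  [set u | [/\ (iota @` simples Delta) u, u <> 1 & summit y (y ^ u)]].

Definition min_conjugators y : set G :=
  [set u | summit_conjugators y u /\
    forall v, summit_conjugators y v -> prec v u -> v = u].

Definition trajectory y : set G :=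
  [set foldl (fun z q => cycling q z) y qs | qs in [set: seq int]].

End GarsideGroup.

(* Main.v *)
(* Let f be a composite of cyclings, f(x) = x^p(x). The transport of u along f
   at x is p(x)^-1 u p(x^u); it conjugates f(x) to f(x^u). For the cycling of
   order q it equals (x /\ D^q)^-1 (xu /\ u D^q), so it is monotone for prec and
   fixes 1 and D = Delta, hence preserves the simple elements. Cyclings commute,
   because the conjugator of c_r c_q is x^2 /\ x D^q /\ x D^r /\ D^(q+r). Hence
   an element periodic under every c_q is periodic under f. When x and x^u are
   both such, the transport of u is periodic as well, so transport along f is an
   isomorphism of posets between the simple conjugators keeping x, respectively
   f(x), in the summit set. Since x2 = f(x1) for some f, the transport u2 of u1
   is minimal for x2, and x2^u2 = f(x1^u1) has the trajectory of x1^u1. *)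
Require Import Defs.
From mathcomp Require Import all_boot ssralg ssrint.
From mathcomp Require Import boolp classical_sets functions cardinality.

Local Open Scope classical_set_scope.
Local Open Scope group_scope.

(** * Iterates of commuting maps and periodic points *)

Section Iter.
Set Implicit Arguments.
Unset Strict Implicit.

Lemma iter_commute (T : Type) (f g : T -> T) (n : nat) (x : T) :
  (forall y, f (g y) = g (f y)) -> iter n f (g x) = g (iter n f x).
Proof. by move=> fgC; elim: n => [|n IHn] //=; rewrite IHn fgC. Qed.

Lemma iter_comp_commute (T : Type) (f g : T -> T) (n : nat) (x : T) :
  (forall y, f (g y) = g (f y)) -> iter n (f \o g) x = iter n f (iter n g x).
Proof.
move=> fgC; elim: n => [|n IHn] //=.
by rewrite IHn -(iter_commute _ _ fgC).
Qed.

Lemma iter_period (T : Type) (f : T -> T) (m n : nat) (x : T) :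
  iter m f x = x -> iter (n * m) f x = x.
Proof. by move=> fx; elim: n => [|n IHn] //; rewrite mulSn iterD IHn. Qed.

End Iter.

(** * Divisibility in a Garside monoid *)

Section Monoid.
Set Implicit Arguments.
Unset Strict Implicit.
Variable M : monoidType.
Implicit Types a b c d x y z : M.

(** Prepending atomic factorizations of [a] and [b] to a longest one of [1] gives again a
    factorization of [1], so the one of [a] has to be empty. *)
Lemma atomic_mulg_eq1 a b : atomic M -> a * b = 1 -> a = 1.
Proof.
move=> [atomic_gen norm_ex] ab1; apply: contrapT => a_neq1.
have [sa [atom_sa def_a]] := atomic_gen a.
have [sb [atom_sb def_b]] := atomic_gen b.
have [n [[s [atom_s def1] size_s] norm_max]] := norm_ex 1.
have: (size (sa ++ sb ++ s) <= n)%N.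
  apply: norm_max; split=> [c|].
    by rewrite !mem_cat => /or3P[/atom_sa|/atom_sb|/atom_s].
  by rewrite !big_cat -def_a -def_b -def1 /= mulg1 ab1.
rewrite !size_cat size_s addnA -[leqRHS]add0n leq_add2r leqn0 addn_eq0.
by case/andP=> /eqP/size0nil sa0 _; apply: a_neq1; rewrite def_a sa0 big_nil.
Qed.

(** The gcd of [a * x] and [a * y] has the form [a * e']; by cancellation [e'] divides [x] and [y],
    hence [d]. *)
Lemma is_glb_ldvd_mull a x y d : cancellative M -> has_gcds_lcms M ->
  is_glb (@ldvd M) x y d -> is_glb (@ldvd M) (a * x) (a * y) (a * d).
Proof.
move=> [cancelL _] gcd_ex [[x' def_x] [y' def_y] d_max].
have [[e [e_x e_y e_max]] _ _ _] := gcd_ex (a * x) (a * y).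
have [e' def_e] : ldvd a e by apply: e_max; [exists x | exists y].
have [d' def_d] : ldvd e' d.
  apply: d_max.
    by case: e_x => z; rewrite def_e -mulgA => /cancelL ->; exists z.
  by case: e_y => z; rewrite def_e -mulgA => /cancelL ->; exists z.
split=> [||f f_x f_y].
- by exists x'; rewrite def_x mulgA.
- by exists y'; rewrite def_y mulgA.
- have [f' def_f] := e_max _ f_x f_y.
  by exists (f' * d'); rewrite def_d mulgA -def_e def_f mulgA.
Qed.

(** For a simple [b], write [Delta = b * b']; the right divisor [b'] is also a left divisor,
    [Delta = b' * b''], so [b * Delta = b * b' * b'' = Delta * b'']. Simple elements generate the
    monoid. *)
Lemma garside_conjr (Delta a : M) : garside_element Delta ->
  exists b, a * Delta = Delta * b.
Proof.
move=> [dvdE _ gen]; have [s [simple_s ->]] := gen a.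
elim: s simple_s => [|b s IHs] simple_s.
  by exists 1; rewrite big_nil mulg1 mul1g.
have [c def_c] : exists c, \prod_(a <- s) a * Delta = Delta * c.
  by apply: IHs => d d_s; apply: simple_s; rewrite inE d_s orbT.
have [b' def_b'] : ldvd b Delta by apply: simple_s; rewrite inE eqxx.
have [b'' def_b''] : ldvd b' Delta by apply/dvdE; exists b.
exists (b'' * c).
by rewrite big_cons -mulgA def_c {1}def_b'' !mulgA -def_b'.
Qed.

Lemma garside_conjl (Delta a : M) : garside_element Delta ->
  exists b, Delta * a = b * Delta.
Proof.
move=> [dvdE _ gen]; have [s [simple_s ->]] := gen a.
elim: s simple_s => [|b s IHs] simple_s.
  by exists 1; rewrite big_nil mulg1 mul1g.
have [c def_c] : exists c, Delta * \prod_(a <- s) a = c * Delta.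
  by apply: IHs => d d_s; apply: simple_s; rewrite inE d_s orbT.
have [b' def_b'] : rdvd b Delta by apply/dvdE/simple_s; rewrite inE eqxx.
have [b'' def_b''] : rdvd b' Delta by apply/dvdE; exists b.
exists (b'' * c).
by rewrite big_cons mulgA {1}def_b'' -!mulgA -def_c (mulgA b') -def_b'.
Qed.

End Monoid.

Section GarsideGroup.
Set Implicit Arguments.
Unset Strict Implicit.
Variables (M : monoidType) (Delta : M) (G : groupType) (iota : M -> G).
Hypothesis garside_M : garside_monoid Delta.
Hypothesis fractions_G : group_of_fractions iota.
Implicit Types (x y z u v w g : G) (q r : int) (qs : seq int) (n : nat).

Local Notation delta := (iota Delta).
Local Notation "x <=M y" := (prec iota x y) (at level 70, y at next level).
Local Notation meetG := (meet iota).
Local Notation cyc := (cycling Delta iota).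
Local Notation deltaX := (expgz delta).

(** * The order on the group of fractions and its translations *)

Lemma garside_injM : {morph iota : a b / a * b}.
Proof. by case: fractions_G => -[]. Qed.

Lemma prec_trans y x z : x <=M y -> y <=M z -> x <=M z.
Proof.
move=> [a _ def_a] [b _ def_b]; exists (a * b) => //.
by rewrite garside_injM def_a def_b mulgA mulgK.
Qed.

Lemma prec_anti x y : x <=M y -> y <=M x -> x = y.
Proof.
case: garside_M fractions_G => _ atomic_M _ _ [[iota1 _] iota_inj _].
move=> [a _ def_a] [b _ def_b].
have a1 : a = 1.
  apply: (@atomic_mulg_eq1 _ a b) => //; apply: iota_inj.
  by rewrite garside_injM def_a def_b iota1 mulgA mulgK mulVg.
by apply: (mulgI x^-1); rewrite -def_a a1 iota1 mulVg.
Qed.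

Lemma prec_mull g x y : g * x <=M g * y <-> x <=M y.
Proof. by rewrite /prec invgM -mulgA mulKg. Qed.

(** Conjugation by [delta] maps the monoid into itself. *)
Lemma prec_mulr_delta x y : x <=M y -> x * delta <=M y * delta.
Proof.
case: garside_M => _ _ _ garside_Delta [a _ def_a].
have [b def_b] := garside_conjr a garside_Delta; exists b => //.
rewrite invgM -!mulgA (mulgA x^-1) -def_a -garside_injM def_b.
by rewrite garside_injM mulKg.
Qed.

Lemma prec_mulr_deltaV x y : x <=M y -> x * delta^-1 <=M y * delta^-1.
Proof.
case: garside_M => _ _ _ garside_Delta [a _ def_a].
have [b def_b] := garside_conjl a garside_Delta; exists b => //.
rewrite invgM invgK -!mulgA (mulgA x^-1) -def_a mulgA -garside_injM def_b.
by rewrite garside_injM mulgK.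
Qed.

Lemma prec_mulr_deltaX q x y : x <=M y -> x * deltaX q <=M y * deltaX q.
Proof.
have expr n : x <=M y -> x * delta ^+ n <=M y * delta ^+ n.
  elim: n => [|n IHn] le_xy; first by rewrite expg0 !mulg1.
  by rewrite expgSr !mulgA; apply/prec_mulr_delta/IHn.
case: q => n; first exact: expr.
rewrite /expgz -expVgn; elim: n.+1 => [|k IHk] le_xy.
  by rewrite expg0 !mulg1.
by rewrite expgSr !mulgA; apply/prec_mulr_deltaV/IHk.
Qed.

Lemma expgzV (g : G) q : exists r, (expgz g q)^-1 = expgz g r.
Proof.
case: q => [[|n]|n].
- by exists (Posz 0); rewrite /= expg0 invg1.
- by exists (Negz n).
- by exists (Posz n.+1); rewrite /= invgK.
Qed.

Lemma prec_mulr_deltaXE q x y : x * deltaX q <=M y * deltaX q <-> x <=M y.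
Proof.
split; last exact: prec_mulr_deltaX.
have [r def_r] := expgzV delta q.
by move=> /(prec_mulr_deltaX r); rewrite -def_r !mulgK.
Qed.

Lemma commute_expgz (g h : G) q : commute g h -> commute g (expgz h q).
Proof.
by move=> ghC; case: q => n; [apply: commuteX | apply/commuteV/commuteX].
Qed.

Lemma deltaXC q r : deltaX q * deltaX r = deltaX r * deltaX q.
Proof.
by apply: commute_expgz; apply/commute_sym/commute_expgz/commute_refl.
Qed.

(** * Existence of meets and their translations *)

Lemma left_denominator z : exists k a : M, iota k * z = iota a.
Proof.
case: garside_M fractions_G => _ _ lcm_ex _ [_ _ frac].
have [e [f ->]] := frac z.
(* A common left multiple [k * e = a * f] turns the right fraction of [e] by [f] into a left one. *)
have [_ _ [m [[k def_k] [a def_a] _]] _] := lcm_ex e f.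
by exists k, a; rewrite mulgA -garside_injM -def_k def_a garside_injM mulgK.
Qed.

Lemma prec_iota a b : iota a <=M iota b <-> ldvd a b.
Proof.
case: fractions_G => _ iota_inj _; split=> [[c _ def_c]|[c ->]].
  by exists c; apply: iota_inj; rewrite garside_injM def_c mulVKg.
by exists c => //; rewrite garside_injM mulKg.
Qed.

Lemma is_glb_mull g x y d :
  is_glb (prec iota) (g * x) (g * y) (g * d) -> is_glb (prec iota) x y d.
Proof.
move=> [/prec_mull d_x /prec_mull d_y d_max]; split=> // e e_x e_y.
by apply/prec_mull/d_max; apply/prec_mull.
Qed.

Lemma is_glb_iota a b d :
  is_glb (@ldvd M) a b d -> is_glb (prec iota) (iota a) (iota b) (iota d).
Proof.
case: garside_M => cancel_M _ gcd_ex _ glb_d.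
split=> [||e e_a e_b].
- by apply/prec_iota; case: glb_d.
- by apply/prec_iota; case: glb_d.
(* A lower bound [e] need not lie in the monoid; left translation by a denominator [k] brings it
   there and keeps the gcd. *)
- have [k [c def_c]] := left_denominator e.
  have [_ _ kd_max] := is_glb_ldvd_mull k cancel_M gcd_ex glb_d.
  apply/(prec_mull (iota k)); rewrite def_c -garside_injM.
  by apply/prec_iota/kd_max; apply/prec_iota;
    rewrite garside_injM -def_c; apply/prec_mull.
Qed.

Lemma is_glb_meet x y : is_glb (prec iota) x y (meetG x y).
Proof.
apply: (@xgetPex _ 1 [set d | is_glb (prec iota) x y d]).
case: garside_M => _ _ gcd_ex _.
have [k [b def_b]] := left_denominator (x^-1 * y).
have [[d glb_d] _ _ _] := gcd_ex k b.
(* Left translation by [iota k * x^-1] sends [x] to [iota k] and [y] to [iota b], whose infimum is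
   [iota d]. *)
exists (x * (iota k)^-1 * iota d); apply: (@is_glb_mull (iota k * x^-1)).
rewrite -[_ * y]mulgA def_b -[_ * x]mulgA mulVg mulg1 !mulgA.
by rewrite mulgVK mulgV mul1g; apply: is_glb_iota.
Qed.

Lemma meet_unique x y d : is_glb (prec iota) x y d -> meetG x y = d.
Proof.
move=> [d_x d_y d_max]; have [m_x m_y m_max] := is_glb_meet x y.
by apply: prec_anti; [apply: d_max | apply: m_max].
Qed.

Lemma mul_meetl g x y : g * meetG x y = meetG (g * x) (g * y).
Proof.
apply/esym/meet_unique/(@is_glb_mull g^-1); rewrite !mulKg.
exact: is_glb_meet.
Qed.

Lemma mul_meet_deltaX q x y :
  meetG x y * deltaX q = meetG (x * deltaX q) (y * deltaX q).
Proof.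
have [m_x m_y m_max] := is_glb_meet x y.
apply/esym/meet_unique; split=> [||e e_x e_y]; try exact: prec_mulr_deltaX.
rewrite -[e](mulgVK (deltaX q)).
by apply/prec_mulr_deltaX/m_max; apply/(prec_mulr_deltaXE q);
  rewrite mulgVK.
Qed.

Lemma meetACA x y z w :
  meetG (meetG x y) (meetG z w) = meetG (meetG x z) (meetG y w).
Proof.
have le_l a b : meetG a b <=M a by case: (is_glb_meet a b).
have le_r a b : meetG a b <=M b by case: (is_glb_meet a b).
have le_meet c a b : c <=M a -> c <=M b -> c <=M meetG a b.
  by case: (is_glb_meet a b) => _ _; apply.
have le2 a b c d : meetG (meetG a b) (meetG c d) <=M
      meetG (meetG a c) (meetG b d).
  by apply: (le_meet); apply: (le_meet);
    [apply: prec_trans (le_l _ _) _|apply: prec_trans (le_r _ _) _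
    |apply: prec_trans (le_l _ _) _|apply: prec_trans (le_r _ _) _];
    [exact: le_l | exact: le_l | exact: le_r | exact: le_r].
by apply: prec_anti; apply: le2.
Qed.

Lemma prec_meet2 x y z w : x <=M z -> y <=M w -> meetG x y <=M meetG z w.
Proof.
move=> le_xz le_yw; have [m_x m_y _] := is_glb_meet x y.
have [_ _ m_max] := is_glb_meet z w.
by apply: m_max; [apply: prec_trans le_xz | apply: prec_trans le_yw].
Qed.

(** * Commuting cyclings, their composites and transport *)

Lemma cycling_comm q r x : cyc q (cyc r x) = cyc r (cyc q x).
Proof.
(* For the first conjugator [p], [p * x ^ p = x * p]; hence both total conjugators are meets of the
   same four terms, with the middle two exchanged. *)
rewrite /cycling -!conjgM !mul_meetl -!conjgC !mul_meet_deltaX.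
by rewrite !mul_meetl meetACA (deltaXC q r).
Qed.

Definition cyclings qs x := foldl (fun z q => cyc q z) x qs.

Fixpoint cyclings_conj qs x :=
  if qs is q :: qs' then
    meetG x (deltaX q) * cyclings_conj qs' (cyc q x)
  else 1.

Definition transport qs x u :=
  (cyclings_conj qs x)^-1 * u * cyclings_conj qs (x ^ u).

Lemma cyclings_cat qs rs x :
  cyclings (qs ++ rs) x = cyclings rs (cyclings qs x).
Proof. exact: foldl_cat. Qed.

Lemma cyclings_conjE qs x : cyclings qs x = x ^ cyclings_conj qs x.
Proof.
elim: qs x => [|q qs IHqs] x; first by rewrite /= conjg1.
by rewrite /= IHqs conjgM.
Qed.

Lemma cyclings_conj_cat qs rs x :
  cyclings_conj (qs ++ rs) x =
    cyclings_conj qs x * cyclings_conj rs (cyclings qs x).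
Proof.
by elim: qs x => [|q qs IHqs] x; rewrite ?mul1g //= IHqs mulgA.
Qed.

Lemma cyclings_conjg qs x u :
  cyclings qs (x ^ u) = cyclings qs x ^ transport qs x u.
Proof.
by rewrite !cyclings_conjE -!conjgM /transport !mulgA mulgV mul1g.
Qed.

Lemma transport_cat qs rs x u :
  transport (qs ++ rs) x u = transport rs (cyclings qs x) (transport qs x u).
Proof.
rewrite /transport -cyclings_conjg !cyclings_conj_cat invgM.
by rewrite !mulgA.
Qed.

Lemma transport1 qs x : transport qs x 1 = 1.
Proof. by rewrite /transport conjg1 mulg1 mulVg. Qed.

(** As [u * x ^ u = x * u], the conjugate [x ^ u] disappears, and [u] only undergoes left
    translations, right translation by a power of [delta] and a meet, all monotone. *)
Lemma transport_seq1 q x u : transport [:: q] x u =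
  (meetG x (deltaX q))^-1 * meetG (x * u) (u * deltaX q).
Proof.
by rewrite /transport /= !mulg1 -mulgA mul_meetl -conjgC.
Qed.

Lemma transport_mono qs x u v :
  u <=M v -> transport qs x u <=M transport qs x v.
Proof.
elim: qs x u v => [|q qs IHqs] x u v le_uv.
  by rewrite /transport /= invg1 !mul1g !mulg1.
rewrite -cat1s !transport_cat; apply: IHqs; rewrite !transport_seq1.
apply/prec_mull/prec_meet2; first exact/prec_mull.
exact: prec_mulr_deltaX.
Qed.

Lemma transport_delta qs x : transport qs x delta = delta.
Proof.
elim: qs x => [|q qs IHqs] x.
  by rewrite /transport /= invg1 mul1g mulg1.
rewrite -cat1s transport_cat transport_seq1.
have -> : delta * deltaX q = deltaX q * delta.
  exact/commute_expgz/commute_refl.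
(* Right translation by [delta] comes out of the meet, leaving the conjugator of [x] to cancel. *)
by have /= <- := mul_meet_deltaX (Posz 1) x (deltaX q); rewrite mulKg.
Qed.

Lemma mem_simples u : (iota @` simples Delta) u <-> 1 <=M u /\ u <=M delta.
Proof.
case: fractions_G => -[iota1 _] _ _; split=> [[a dvd_a <-]|].
  by rewrite -iota1 !prec_iota; split=> //; exists a; rewrite mul1g.
move=> [[a _ def_a]]; rewrite invg1 mul1g in def_a.
by rewrite -def_a prec_iota => dvd_a; exists a.
Qed.

Lemma transport_simples qs x u :
  (iota @` simples Delta) u -> (iota @` simples Delta) (transport qs x u).
Proof.
rewrite !mem_simples => -[ge1_u le_u_delta].
by rewrite -(transport1 qs x) -(transport_delta qs x);
  split; apply: transport_mono.
Qed.

(** * Periodicity under composite cyclings, and trajectories *)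

Definition recurrent x := forall q, cyclic_part Delta iota q x.

Lemma iter_cycling_cyclings n q qs x :
  iter n (cyc q) (cyclings qs x) = cyclings qs (iter n (cyc q) x).
Proof.
apply: iter_commute => y.
by elim: qs y => [|r qs IHqs] y //=; rewrite IHqs cycling_comm.
Qed.

Lemma recurrent_cyclings qs x : recurrent x -> recurrent (cyclings qs x).
Proof.
move=> rec_x q; have [n n_gt0 xn] := rec_x q.
by exists n => //; rewrite iter_cycling_cyclings xn.
Qed.

(** Iterates of a composite cycling are encoded as order lists, so that [cyclings] and [transport]
    apply to them directly. *)
Definition rep n qs := iter n (cat qs) [::].

Lemma repS n qs : rep n.+1 qs = qs ++ rep n qs. Proof. by []. Qed.

Lemma repD m n qs : rep (m + n) qs = rep m qs ++ rep n qs.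
Proof. by elim: m => [|m IHm] //=; rewrite -catA -IHm. Qed.

Lemma repM m n qs : rep (m * n) qs = rep m (rep n qs).
Proof. by elim: m => [|m IHm] //; rewrite mulSn repD IHm. Qed.

Lemma cyclings_rep n qs x : cyclings (rep n qs) x = iter n (cyclings qs) x.
Proof.
by elim: n x => [|n IHn] x //; rewrite repS cyclings_cat IHn -iterSr.
Qed.

Lemma recurrent_period qs x : recurrent x ->
  exists2 n, (0 < n)%N & cyclings (rep n qs) x = x.
Proof.
move=> rec_x; elim: qs => [|q qs [m m_gt0 xm]]; first by exists 1%N.
have [n n_gt0 xn] := rec_x q.
(* The composite of [qs] commutes with [cyc q], so its iterates split, and a common multiple of the
   two periods fixes [x]. *)
exists (m * n)%N; first by rewrite muln_gt0 m_gt0.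
rewrite cyclings_rep (eq_iter (f' := cyclings qs \o cyc q)) //.
rewrite iter_comp_commute => [|y]; last exact/esym/(iter_cycling_cyclings 1%N).
by rewrite (iter_period m xn) mulnC iter_period // -cyclings_rep.
Qed.

Lemma trajectory_cyclings qs x : recurrent x ->
  trajectory Delta iota (cyclings qs x) = trajectory Delta iota x.
Proof.
move=> rec_x; apply/seteqP; split=> _ [rs _ <-].
  by exists (qs ++ rs) => //; apply: cyclings_cat.
have [[|n] // _ xn] := recurrent_period qs rec_x.
(* With period [n.+1], the [n] remaining rounds lead from [cyclings qs x] back to [x]. *)
exists (rep n qs ++ rs) => //; rewrite foldl_cat; congr foldl.
by rewrite -[RHS]xn repS cyclings_cat.
Qed.

Lemma cyclings_conj_rep n qs x : cyclings qs x = x ->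
  cyclings_conj (rep n qs) x = cyclings_conj qs x ^+ n.
Proof.
move=> fx; elim: n => [|n IHn] //.
by rewrite repS cyclings_conj_cat fx IHn expgS.
Qed.

Lemma transport_rep_fixed n qs x u : transport qs x u = u ->
  cyclings qs x = x -> transport (rep n qs) x u = u.
Proof.
move=> fu fx; elim: n => [|n IHn].
  by rewrite /transport /= invg1 mul1g mulg1.
by rewrite repS transport_cat fu fx.
Qed.

(* On conjugators from [x] to [x ^ u], both fixed by the cyclings, the transport
   is [u |-> a^-1 u b] with [a] and [b] independent of [u], hence injective; as
   there are finitely many simple elements, it is periodic. *)
Lemma transport_period_fixed qs x u : (iota @` simples Delta) u ->
  cyclings qs x = x -> cyclings qs (x ^ u) = x ^ u ->
  exists2 n, (0 < n)%N & transport (rep n qs) x u = u.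
Proof.
move=> simple_u fx fxu.
have [i [j [lt_ij]]] : exists i j, (i < j)%N /\
    transport (rep i qs) x u = transport (rep j qs) x u.
  apply: contrapT => no_rep; case: infinite_nat.
  have fin_S : finite_set (iota @` simples Delta).
    by case: garside_M => _ _ _ [_ fin_S _]; apply: finite_image.
  pose T i := transport (rep i qs) x u.
  have -> : [set: nat] = T @^-1` (iota @` simples Delta).
    by apply/seteqP; split=> // i _; apply: transport_simples.
  apply: finite_preimage => // i j _ _ eqT.
  by case: (ltngtP i j) => // lt_ij; case: no_rep; [exists i, j | exists j, i].
rewrite /transport !cyclings_conj_rep // -(subnK (ltnW lt_ij)) !expgnDr.
rewrite invgM -!mulgA => /mulgI; rewrite !mulgA => /mulIg eq_u.
exists (j - i)%N; first by rewrite subn_gt0.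
by rewrite !cyclings_conj_rep.
Qed.

Lemma transport_period qs x u : (iota @` simples Delta) u ->
  recurrent x -> recurrent (x ^ u) ->
  exists n, [/\ (0 < n)%N, cyclings (rep n qs) x = x &
                transport (rep n qs) x u = u].
Proof.
move=> simple_u rec_x rec_xu.
have [m m_gt0 xm] := recurrent_period qs rec_x.
have [n n_gt0 xun] := recurrent_period qs rec_xu.
(* A common multiple of the periods of [x] and [x ^ u] gives a composite cycling fixing both. *)
have fx : cyclings (rep (n * m) qs) x = x.
  by rewrite cyclings_rep iter_period -?cyclings_rep.
have [||k k_gt0 uk] := @transport_period_fixed (rep (n * m) qs) x u simple_u.
- exact: fx.
- by rewrite mulnC cyclings_rep iter_period -?cyclings_rep.
exists (k * (n * m))%N; rewrite !muln_gt0 k_gt0 n_gt0; split=> //.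
  by rewrite repM cyclings_rep iter_fix.
by rewrite repM.
Qed.

Lemma rep_rcons n qs : rep n.+1 qs = rep n qs ++ qs.
Proof. by rewrite -addn1 repD [rep 1 qs]cats0. Qed.

Lemma transport_period_mul k n qs x u :
  cyclings (rep n qs) x = x -> transport (rep n qs) x u = u ->
  cyclings (rep (k * n) qs) x = x /\ transport (rep (k * n) qs) x u = u.
Proof.
move=> fx fu; rewrite repM transport_rep_fixed //; split=> //.
by rewrite cyclings_rep iter_fix.
Qed.

(** * Minimal conjugators and their transport *)

Lemma summit_conjugatorsP x u : recurrent x ->
  summit_conjugators Delta iota x u <->
    [/\ (iota @` simples Delta) u, u <> 1 & recurrent (x ^ u)].
Proof.
move=> rec_x; split=> [[simple_u u_neq1 [_ rec_xu]]|[simple_u u_neq1 rec_xu]].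
  by split=> // q; apply: rec_xu.
by split=> //; split=> [|q _]; [exists u | apply: rec_xu].
Qed.

(* Going once around a common period inverts the transport of [x], while
   preserving the order; hence minimal conjugators are transported to minimal
   conjugators. *)
Lemma min_conjugators_transport qs x u : recurrent x ->
  min_conjugators Delta iota x u ->
  min_conjugators Delta iota (cyclings qs x) (transport qs x u).
Proof.
move=> rec_x [/(summit_conjugatorsP _ rec_x) [simple_u u_neq1 rec_xu] min_u].
have rec_fx := recurrent_cyclings qs rec_x.
have [m [m_gt0 xm um]] := transport_period qs simple_u rec_x rec_xu.
split.
  apply/summit_conjugatorsP => //; split.
  - exact: transport_simples.
  (* The remaining rounds of the period would carry the transport [1] to [1], yet they must return
     [u]. *)
  - move=> fu1; apply: u_neq1; rewrite -um -(prednK m_gt0) repS transport_cat.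
    by rewrite fu1 transport1.
  - by rewrite -cyclings_conjg; apply: recurrent_cyclings.
move=> v /(summit_conjugatorsP _ rec_fx) [simple_v v_neq1 rec_fxv] le_v.
have [n [n_gt0 xn vn]] := transport_period qs simple_v rec_fx rec_fxv.
have [xk uk] := transport_period_mul n xm um.
have [fxk vk] := transport_period_mul m xn vn.
rewrite (mulnC m) in fxk vk.
have : (0 < n * m)%N by rewrite muln_gt0 n_gt0.
case: (n * m)%N xk uk fxk vk => // k xk uk fxk vk _.
(* Here [k.+1] is a common period for the pairs [x], [u] and [cyclings qs x], [v]; thus [k] rounds
   undo one, and [w] below is the preimage of [v]. *)
have xk' : cyclings (rep k qs) (cyclings qs x) = x.
  by rewrite -cyclings_cat -repS.
pose w := transport (rep k qs) (cyclings qs x) v.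
have fw : transport qs x w = v.
  by rewrite -[RHS]vk rep_rcons transport_cat xk'.
suff <- : w = u by rewrite fw.
apply: min_u.
  apply/summit_conjugatorsP => //; split.
  - exact: transport_simples.
  - by move=> w1; apply: v_neq1; rewrite -fw w1 transport1.
  - by rewrite -{1}xk' -cyclings_conjg; apply: recurrent_cyclings.
(* Both [w] and [u] are images under the same [k] rounds, of [v] and of the transport of [u];
   monotonicity applies to [le_v]. *)
by rewrite -[u in _ <=M u]uk repS transport_cat; apply: transport_mono.
Qed.

End GarsideGroup.

Theorem theorem3p7 (M : monoidType) (Delta : M) (G : groupType) (iota : M -> G)
    (garside_M : garside_monoid Delta) (fractions_G : group_of_fractions iota)
    (x x1 x2 : G)
    (x1_summit : summit Delta iota x x1) (x2_summit : summit Delta iota x x2)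
    (same_trajectory : trajectory Delta iota x1 = trajectory Delta iota x2)
    (u1 : G) (u1_min : min_conjugators Delta iota x1 u1) :
  exists2 u2 : G, min_conjugators Delta iota x2 u2 &
    trajectory Delta iota (x1 ^ u1) = trajectory Delta iota (x2 ^ u2).
Proof.
have rec_x1 : recurrent Delta iota x1 by move=> q; case: x1_summit => _; apply.
have rec_x1u1 : recurrent Delta iota (x1 ^ u1).
  by move=> q; case: u1_min => -[_ _ [_ +]] _; apply.
have [qs _ <-] : trajectory Delta iota x1 x2.
  (* The empty composite puts [x2] in its own trajectory, hence in that of [x1]. *)
  by rewrite same_trajectory; exists [::].
exists (transport Delta iota qs x1 u1); first exact: min_conjugators_transport.
by rewrite -cyclings_conjg trajectory_cyclings.
Qed.
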